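(* Let $\Theta$ and $Y$ be measurable spaces, and let the following be given: a probability $d\theta$ on $\Theta$; a measurable probability density function $\pi_a:\Theta\to(0,+\infty)$ (with respect to $d\theta$), with associated probability $d\nu(\theta):=\pi_a(\theta)\,d\theta$; a measurable and bounded function $l:\Theta\times Y\to(0,+\infty)$; an IFS (measurable map) $\tau:\Theta\times Y\to Y$, written $\tau_\theta(y)=\tau(\theta,y)$; a measurable and bounded function $\psi:Y\to(0,+\infty)$, together with $$\varphi(y)=\frac{1}{\psi(y)}\int l(\theta,y)\,\psi(\tau_\theta(y))\,d\nu(\theta),\qquad \bar l(\theta,y)=\frac{l(\theta,y)\,\psi(\tau_\theta(y))}{\int l(\theta',y)\,\psi(\tau_{\theta'}(y))\,\pi_a(\theta')\,d\theta'};$$ and a probability $\rho$ on $Y$ which is stationary with respect to $(\bar l,\nu,\tau)$. Suppose furthermore that $\pi_a$ is bounded and that there exists a constant $a>0$ such that $a<l(\theta,y)$ for all $(\theta,y)\in\Theta\times Y$ and $a<\psi(y)$ for all $y\in Y$. Consider the variational problem $$\sup_{\tilde\pi\ \text{holonomic}}\ \left\{\int\big[\log(l(\theta,y))+\log(\pi_a(\theta))-\log(\varphi(y))\big]\,d\tilde\pi(\theta,y)+H^{d\theta}(\tilde\pi)\right\},$$ where the supremum is over all probabilities $\tilde\pi$ on $\Theta\times Y$ that are holonomic with respect to $\tau$. Then this supremum is equal to zero, and it is attained at the posterior probability $\pi$ on $\Theta\times Y$ defined by $d\pi=\bar l(\theta,y)\,\pi_a(\theta)\,d\theta\,d\rho(y)$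 (for any choice of stationary probability $\rho$ with respect to $(\bar l,\nu,\tau)$, if there is more than one).
   Context: Definitions. Let $\Theta,Y$ be measurable spaces and $\nu$ a probability on $\Theta$. An IFS is a measurable map $\tau:\Theta\times Y\to Y$, regarded as a family of maps $\tau_\theta:Y\to Y$, $\theta\in\Theta$. A measurable function $g:\Theta\times Y\to[0,+\infty)$ is a $\nu$-Jacobian if $\int g(\theta,y)\,d\nu(\theta)=1$ for all $y\in Y$. (The function $\bar l$ of the claim is a $\nu$-Jacobian, and $\bar l(\theta,y)=\frac{l(\theta,y)\psi(\tau_\theta(y))}{\psi(y)\varphi(y)}$.) A probability $\pi$ on $\Theta\times Y$ is holonomic with respect to $\tau$ if for any measurable and bounded function $g:Y\to\mathbb{R}$, $\int g(y)\,d\pi(\theta,y)=\int g(\tau_\theta(y))\,d\pi(\theta,y)$. Given a $\nu$-Jacobian $\bar l$, a probability $\rho$ on $Y$ is stationary with respect to $(\bar l,\nu,\tau)$ if for any measurable and bounded function $g:Y\to\mathbb{R}$, $\int\int \bar l(\theta,y)\,g(\tau_\theta(y))\,d\nu(\theta)\,d\rho(y)=\int g(y)\,d\rho(y)$. The entropy of a probability $\pi$ on $\Theta\times Y$ with respect to a probability $\nu$ on $\Theta$ is $$H^{\nu}(\pi)=-\sup\left\{\int\log(J)\,d\pi\ :\ J\text{ is a }\nu\text{-Jacobian}\right\},$$ where the supremum is over those $J$ such that $\log(J)$ has a well-defined integral with respect to $\pi$. (Thus $H^\nu(\pi)\le 0$, and the value $-\infty$ is allowed.) $H^{d\theta}$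 denotes this entropy with $\nu$ replaced by the probability $d\theta$. *)

(* Defs.v *)
(* MathComp-Analysis. *)
From HB Require Import structures.
From mathcomp Require Export all_boot all_order all_algebra.
From mathcomp Require Export all_classical all_reals all_analysis.

Set Implicit Arguments.
Unset Strict Implicit.
Unset Printing Implicit Defensive.

Export Order.TTheory GRing.Theory Num.Theory.
Export numFieldNormedType.Exports.

Local Open Scope classical_set_scope.
Local Open Scope ring_scope.

(* d nu = f d mu, for f nonnegative and measurable. *)
Definition has_density (R : realType) (d : measure_display)
    (X : measurableType d) (mu : {measure set X -> \bar R}) (f : X -> R)
    (nu : {measure set X -> \bar R}) : Prop :=
  forall A : set X, measurable A -> nu A = (\int[mu]_(x in A) (f x)%:E)%E.

Section ThetaY.
Context (R : realType) (d1 d2 : measure_display).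
Context (Theta : measurableType d1) (Y : measurableType d2).

Definition is_jacobian (nu : probability Theta R) (J : Theta * Y -> R) : Prop :=
  [/\ measurable_fun setT J,
      forall x, 0 <= J x &
      forall y, (\int[nu]_t (J (t, y))%:E)%E = 1%E].

Definition holonomic (tau : Theta * Y -> Y)
    (pi : probability (Theta * Y)%type R) : Prop :=
  forall g : Y -> R, measurable_fun setT g -> [bounded g y | y in setT] ->
    (\int[pi]_x (g x.2)%:E = \int[pi]_x (g (tau x))%:E)%E.

Definition stationary (lbar : Theta * Y -> R) (nu : probability Theta R)
    (tau : Theta * Y -> Y) (rho : probability Y R) : Prop :=
  forall g : Y -> R, measurable_fun setT g -> [bounded g y | y in setT] ->
    (\int[rho]_y \int[nu]_t (lbar (t, y) * g (tau (t, y)))%:E =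
     \int[rho]_y (g y)%:E)%E.

(* The positive and negative parts do not both have infinite integral; the
   value of the integral may be infinite. *)
Definition integral_defined (pi : probability (Theta * Y)%type R)
    (f : Theta * Y -> \bar R) : Prop :=
  ((\int[pi]_x (f^\+ x)) +? (- \int[pi]_x (f^\- x)))%E.

(* J may vanish, hence [lne], for which log 0 = -oo. *)
Definition entropy (nu : probability Theta R)
    (pi : probability (Theta * Y)%type R) : \bar R :=
  (- ereal_sup [set \int[pi]_x lne (J x)%:E | J in
       [set J : Theta * Y -> R | is_jacobian nu J /\
          integral_defined pi (fun x => lne (J x)%:E)]])%E.

Definition phi (nu : probability Theta R) (l : Theta * Y -> R)
    (tau : Theta * Y -> Y) (psi : Y -> R) (y : Y) : R :=
  (psi y)^-1 * \int[nu]_t (l (t, y) * psi (tau (t, y))).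

Definition lbar (P : probability Theta R) (pia : Theta -> R)
    (l : Theta * Y -> R) (tau : Theta * Y -> Y) (psi : Y -> R)
    (x : Theta * Y) : R :=
  l x * psi (tau x) /
  \int[P]_t (l (t, x.2) * psi (tau (t, x.2)) * pia t).

(* When pia and l are bounded above and varphi is bounded below by a positive
   constant, the integral lies in [-oo, +oo[ and the entropy in [-oo, 0], so
   that the sum never has the form +oo - oo. *)
Definition objective (P : probability Theta R) (l : Theta * Y -> R)
    (pia : Theta -> R) (varphi : Y -> R)
    (pi : probability (Theta * Y)%type R) : \bar R :=
  (\int[pi]_x (ln (l x) + ln (pia x.1) - ln (varphi x.2))%:E +
   entropy P pi)%E.

End ThetaY.

(* Main.v *)
(* The posterior density [J0 = lbar * pia] is a positive bounded Jacobian with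
   respect to dtheta, and the integrand of the variational problem is
   [ln J0 + ln psi - ln (psi o tau)]. The last two terms integrate to zero
   against a holonomic probability, so taking J0 as a competitor in the
   entropy bounds the objective by 0. Against the probability of density J0,
   Gibbs' inequality shows that J0 realizes the supremum in the entropy, hence
   equality; stationarity of rho makes this probability holonomic. *)
Require Import Defs.
From HB Require Import structures.
From mathcomp Require Import measurable_realfun ring lra.

Set Implicit Arguments.
Unset Strict Implicit.
Unset Printing Implicit Defensive.

Local Open Scope classical_set_scope.
Local Open Scope ring_scope.

Lemma bounded_fun_setTP (R : realType) (X : Type) (f : X -> R) :
  [bounded f x | x in setT] <-> exists M : R, forall x, `|f x| <= M.
Proof.
split.
  move=> /pinfty_ex_gt0[M _ fM]; exists M => x; exact: fM.
move=> [M fM]; exists M; split; first exact: num_real.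
by move=> N MN x _ /=; rewrite (le_trans (fM x))// ltW.
Qed.

(** * Measures given by a density *)

Section density.
Local Open Scope ereal_scope.
Context (R : realType) (d : measure_display) (X : measurableType d).
Variables (mu : {measure set X -> \bar R}) (f : X -> R).
Hypotheses (mf : measurable_fun setT f) (f0 : forall x, (0 <= f x)%R).

Import HBNNSimple.

(** The hypothesis is the case of indicators. Linearity extends it to nonnegative simple functions,
    and monotone convergence along an increasing simple approximation of [g] does the rest. *)
Lemma ge0_integral_density (nu : {measure set X -> \bar R}) (g : X -> \bar R) :
    has_density mu f nu -> measurable_fun setT g -> (forall x, 0 <= g x) ->
  \int[nu]_x g x = \int[mu]_x (g x * (f x)%:E).
Proof.
move=> dnu mg g0.
have mfE : measurable_fun setT (EFin \o f) by exact/measurable_EFinP.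
have fE0 x : 0 <= (f x)%:E by rewrite lee_fin.
have nnsfun_density (h : {nnsfun X >-> R}) :
    \int[nu]_x (h x)%:E = \int[mu]_x ((h x)%:E * (f x)%:E).
  rewrite integralT_nnsfun sintegralE.
  (* Decompose [h] over its level sets; on each of them [has_density] applies. *)
  transitivity (\sum_(r \in range h)
      \int[mu]_x ((r * \1_(h @^-1` [set r]) x)%:E * (f x)%:E)).
    apply: eq_fsbigr => r /[!inE] -[x _ <-].
    rewrite dnu// integral_mkcond -ge0_integralZl//; last 3 first.
    - by apply/measurable_restrict => //; exact: measurable_funTS.
    - by move=> y _; rewrite erestrict_ge0.
    - by rewrite lee_fin.
    apply: eq_integral => y _; rewrite EFinM -muleA; congr *%E.
    by rewrite epatch_indic muleC.
  rewrite -ge0_integral_fsum//; last 2 first.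
  - move=> r; apply: emeasurable_funM => //.
    exact/measurable_EFinP/measurable_funM.
  - by move=> r x _; rewrite mule_ge0// nnfun_muleindic_ge0.
  apply: eq_integral => x _; rewrite [in RHS]fimfunE -fsumEFin//.
  by rewrite ge0_mule_fsuml// => r; rewrite nnfun_muleindic_ge0.
pose g_ := nnsfun_approx measurableT mg.
have mg_ n : measurable_fun setT (fun x => (g_ n x)%:E).
  exact/measurable_EFinP.
have g_0 n x : 0 <= (g_ n x)%:E by rewrite lee_fin.
have nd_g x m n : (m <= n)%N -> (g_ m x)%:E <= (g_ n x)%:E.
  by move=> mn; rewrite lee_fin; exact/lefP/nd_nnsfun_approx.
have g_cvg x : (g_ n x)%:E @[n --> \oo] --> g x.
  exact: cvg_nnsfun_approx.
transitivity (limn (fun n => \int[nu]_x (g_ n x)%:E)).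
  rewrite -monotone_convergence//; last by move=> x _ m n; exact: nd_g.
  by apply: eq_integral => x _; exact/esym/cvg_lim.
(* Multiplying by the finite nonnegative number [f x] keeps the approximation increasing and
   convergent, so monotone convergence applies under [mu] too. *)
under eq_fun do rewrite nnsfun_density.
rewrite -monotone_convergence//.
- apply: eq_integral => x _; apply/cvg_lim => //.
  exact: cvgeZr.
- by move=> n; exact: emeasurable_funM.
- by move=> n x _; rewrite mule_ge0.
- by move=> x _ m n mn; rewrite lee_wpmul2r// nd_g.
Qed.

Lemma density_probability : \int[mu]_x (f x)%:E = 1 ->
  exists nu : probability X R, has_density mu f nu.
Proof.
move=> f1.
have mfE : measurable_fun setT (EFin \o f) by exact/measurable_EFinP.
pose m (A : set X) := \int[mu]_(x in A) (f x)%:E.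
have m0 : m set0 = 0 by rewrite /m integral_set0.
have m_ge0 A : 0 <= m A by apply: integral_ge0 => x _; rewrite lee_fin.
have m_sigma : semi_sigma_additive m.
  move=> F mF tF mUF; rewrite /m ge0_integral_bigcup//.
  - apply: is_cvg_nneseries => n _ _; exact: m_ge0.
  - exact: measurable_funTS.
  - by move=> x _; rewrite lee_fin.
pose m_measure := isMeasure.Build d X R m m0 m_ge0 m_sigma.
pose M : {measure set X -> \bar R} := HB.pack m m_measure.
pose m_probability := Measure_isProbability.Build d X R M f1.
by exists (HB.pack_for (probability X R) m m_measure m_probability).
Qed.

End density.

(** * Measurability and elementary inequalities *)

Lemma measurable_inv_gt0 (R : realType) (d : measure_display)
    (X : measurableType d) (f : X -> R) : measurable_fun setT f ->
  (forall x, 0 < f x) -> measurable_fun setT (fun x => (f x)^-1).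
Proof.
move=> mf f0; rewrite (_ : (fun x => _) = (@powR R ^~ (-1)) \o f).
  by apply: measurableT_comp => //; exact: measurable_powR.
by apply/funext => x /=; rewrite powR_inv1// ltW.
Qed.

Lemma measurable_lne_EFin (R : realType) (d : measure_display)
    (X : measurableType d) (f : X -> R) : measurable_fun setT f ->
  measurable_fun setT (fun x => lne (f x)%:E).
Proof.
move=> mf; apply: measurable_fun_ifT => //.
- exact: measurable_fun_ler.
- by apply/measurable_EFinP/measurableT_comp => //; exact: measurable_ln.
Qed.

(** Meant for integrands such as [lne (J x)%:E], whose integral may be infinite: positive and
    negative parts are compared separately. *)
Lemma measurable_le_integral (R : realType) (d : measure_display)
    (X : measurableType d) (mu : {measure set X -> \bar R})
    (f g : X -> \bar R) : measurable_fun setT f -> measurable_fun setT g ->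
  (forall x, (f x <= g x)%E) -> (\int[mu]_x f x <= \int[mu]_x g x)%E.
Proof.
move=> mf mg fg; rewrite [leLHS]integralE [leRHS]integralE; apply: leeB.
- apply: ge0_le_integral => //; [exact: measurable_funepos..|].
  by move=> x _; apply: (@funepos_le _ _ setT) => //; rewrite in_setT.
- apply: ge0_le_integral => //; [exact: measurable_funeneg..|].
  by move=> x _; apply: (@funeneg_le _ _ setT) => //; rewrite in_setT.
Qed.

(** Apply [ln u <= u] to [x] when [1 <= x], and to its inverse otherwise. This bound dominates
    [ln J0] against the density [J0]. *)
Lemma norm_ln_mul_le (R : realType) (x : R) : 0 < x ->
  `|ln x| * x <= 1 + x ^+ 2.
Proof.
move=> x0; have [x1|x1] := leP 1 x.
  rewrite ger0_norm ?ln_ge0// (@le_trans _ _ (x ^+ 2)) ?lerDr//.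
  by rewrite expr2 ler_wpM2r ?ltW// ln_sublinear.
rewrite ler0_norm ?ln_le0 ?(ltW x1)// -lnV ?posrE// (@le_trans _ _ (x^-1 * x))//.
  by rewrite ler_wpM2r ?ltW// ln_sublinear// invr_gt0.
by rewrite mulVf ?gt_eqF// lerDl sqr_ge0.
Qed.

(** * Entropy of a probability whose density is a Jacobian *)

Section entropy_density.
Local Open Scope ereal_scope.
Context (R : realType) (d1 d2 : measure_display).
Context (Theta : measurableType d1) (Y : measurableType d2).
Variables (P : probability Theta R) (J0 : Theta * Y -> R) (M : R).
Hypotheses (J0_jacobian : is_jacobian P J0) (J0_gt0 : forall x, (0 < J0 x)%R)
  (J0_le : forall x, (J0 x <= M)%R).

Let mJ0 : measurable_fun setT J0. Proof. by case: J0_jacobian. Qed.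

Let mlnJ0 : measurable_fun setT (fun x => ln (J0 x)).
Proof. by apply: measurableT_comp => //; exact: measurable_ln. Qed.

Let J0_ge0 x : (0 <= J0 x)%R. Proof. exact: ltW. Qed.

Lemma entropy_le_integral_ln (pi : probability (Theta * Y)%type R) :
  pi.-integrable setT (fun x => (ln (J0 x))%:E) ->
  entropy P pi <= - \int[pi]_x (ln (J0 x))%:E.
Proof.
move=> iJ0; rewrite /entropy leeN2; apply: ereal_sup_ubound.
have lneJ0 : (fun x => lne (J0 x)%:E) = (fun x => (ln (J0 x))%:E).
  by apply/funext => x; rewrite lne_EFin.
exists J0; last by rewrite lneJ0.
by split => //; rewrite lneJ0; exact: integrable_add_def.
Qed.

(** Used twice: for a competitor in Gibbs' inequality, and for [J0] itself, to see that the
    posterior has total mass 1. *)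
Lemma integral_jacobian (rho : probability Y R) (J : Theta * Y -> R) :
  is_jacobian P J -> \int[P \x rho]_x (J x)%:E = 1.
Proof.
move=> [mJ J_ge0 J1]; rewrite (fubini_tonelli2 (EFin \o J))//; last first.
  exact/measurable_EFinP.
rewrite /fubini_G; under eq_integral do rewrite J1.
by rewrite integral_cst//= probability_setT mule1.
Qed.

Section density.
Variables (rho : probability Y R) (pi : probability (Theta * Y)%type R).
Hypothesis pi_density : has_density (P \x rho) J0 pi.

(** Although [ln J0] may be unbounded below, the weight [J0] compensates: [|ln J0| * J0] is at most
    [1 + M ^+ 2]. *)
Lemma integrable_ln_density : pi.-integrable setT (fun x => (ln (J0 x))%:E).
Proof.
have M0 : (0 <= M)%R by exact: le_trans (J0_le (point, point)).
apply/integrableP; split; first exact/measurable_EFinP.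
under eq_integral do rewrite abse_EFin.
rewrite (ge0_integral_density mJ0 J0_ge0 pi_density)//; last first.
  by apply/measurable_EFinP/measurableT_comp.
apply: (@le_lt_trans _ _ (\int[P \x rho]_x (1 + M ^+ 2)%:E)).
  apply: ge0_le_integral => //.
  - by move=> x _; rewrite -EFinM lee_fin mulr_ge0.
  - apply: emeasurable_funM; last exact/measurable_EFinP.
    by apply/measurable_EFinP/measurableT_comp.
  - move=> x _; rewrite -EFinM lee_fin (le_trans (norm_ln_mul_le _))//.
    by rewrite lerD2l lerXn2r// nnegrE.
by rewrite integral_cst//= probability_setT mule1 ltry.
Qed.

(** Integrate the pointwise bound [ln J <= ln J0 + (J / J0 - 1)], a form of [ln (1 + t) <= t]. The
    correction has integral zero, because integrating [J / J0] against [pi] amounts to integrating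
    [J] against the product measure. *)
Lemma gibbs (J : Theta * Y -> R) : is_jacobian P J ->
  \int[pi]_x lne (J x)%:E <= \int[pi]_x (ln (J0 x))%:E.
Proof.
move=> jJ; have [mJ J_ge0 _] := jJ.
have mJ0V := measurable_inv_gt0 mJ0 J0_gt0.
have mJJ0 : measurable_fun setT (fun x => J x / J0 x)%R.
  exact: measurable_funM.
have JJ0_ge0 x : (0 <= J x / J0 x)%R by rewrite divr_ge0.
have JJ0_1 : \int[pi]_x (J x / J0 x)%:E = 1.
  rewrite (ge0_integral_density mJ0 J0_ge0 pi_density)//; last first.
    exact/measurable_EFinP.
  rewrite -(integral_jacobian rho jJ); apply: eq_integral => x _.
  by rewrite -EFinM divfK// gt_eqF.
have iJJ0 : pi.-integrable setT (fun x => (J x / J0 x)%:E).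
  apply/integrableP; split; first exact/measurable_EFinP.
  under eq_integral do rewrite gee0_abs ?lee_fin//.
  by rewrite JJ0_1 ltry.
have i1 : pi.-integrable setT (fun=> (-1)%:E).
  exact: (finite_measure_integrable_cst pi (-1)).
rewrite [leRHS](_ : _ =
    \int[pi]_x ((ln (J0 x))%:E + ((J x / J0 x)%:E + (-1)%:E))).
  apply: measurable_le_integral; first exact: measurable_lne_EFin.
  - apply: emeasurable_funD; first exact/measurable_EFinP.
    by apply: emeasurable_funD => //; exact/measurable_EFinP.
  (* Where [J] vanishes, the left-hand side is -oo. *)
  - move=> x; have [Jx0|Jx0] := leP (J x) 0%R.
      by rewrite le0_lneNy ?leNye.
    rewrite lne_EFin// -!EFinD lee_fin -lerBlDl -ln_div ?posrE//.
    have := @le_ln1Dx R (J x / J0 x - 1)%R; rewrite subrKC; apply.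
    by rewrite ltrBrDr addNr divr_gt0.
rewrite integralD//; last 2 first.
- exact: integrable_ln_density.
- exact: integrableD.
rewrite integralD// JJ0_1 integral_cst//= probability_setT mule1.
by rewrite -EFinD subrr adde0.
Qed.

Lemma entropy_density : entropy P pi = - \int[pi]_x (ln (J0 x))%:E.
Proof.
apply/eqP; rewrite eq_le entropy_le_integral_ln//=; last first.
  exact: integrable_ln_density.
by rewrite /entropy leeN2; apply: ge_ereal_sup => _ [J [jJ _] <-]; exact: gibbs.
Qed.

End density.

End entropy_density.

(** * Integrals of functions bounded on one or both sides *)

(** The upper bound makes the positive part integrable, so a failure of integrability can only come
    from the negative part. *)
Lemma not_integrable_integral_Ny (R : realType) (d : measure_display)
    (X : measurableType d) (p : probability X R) (f : X -> R) (C : R) :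
    measurable_fun setT f -> (forall x, f x <= C) ->
    ~ p.-integrable setT (EFin \o f) ->
  (\int[p]_x (f x)%:E = -oo)%E.
Proof.
move=> mf fC nif; have mfE : measurable_fun setT (EFin \o f).
  exact/measurable_EFinP.
have fpos : (\int[p]_x ((EFin \o f)^\+ x) < +oo)%E.
  apply: (@le_lt_trans _ _ (\int[p]_x `|C|%:E)%E).
    apply: ge0_le_integral => //; first exact: measurable_funepos.
    move=> x _; rewrite funeposE /= -EFin_max lee_fin ge_max normr_ge0 andbT.
    by rewrite (le_trans (fC x))// ler_norm.
  by rewrite integral_cst//= probability_setT mule1 ltry.
have fneg : (\int[p]_x ((EFin \o f)^\- x) = +oo)%E.
  apply: contra_notP nif => fneg; apply/integrableP; split => //.
  rewrite [X in (X < _)%E](_ : _ =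
      (\int[p]_x (((EFin \o f)^\+ \+ (EFin \o f)^\-) x))%E); last first.
    by rewrite -fune_abse.
  rewrite ge0_integralD//; [|exact: measurable_funepos|exact: measurable_funeneg].
  by rewrite lte_add_pinfty// ltey; exact/eqP.
rewrite integralE fneg /= -/(EFin \o f).
by move: fpos; case: (\int[p]_x _)%E.
Qed.

Lemma bounded_integrable (R : realType) (d : measure_display)
    (X : measurableType d) (p : probability X R) (f : X -> R) (M : R) :
    measurable_fun setT f -> (forall x, `|f x| <= M) ->
  p.-integrable setT (EFin \o f).
Proof.
move=> mf fM; apply: measurable_bounded_integrable => //.
- by rewrite -ge0_fin_numE// fin_num_measure.
- by apply/bounded_fun_setTP; exists M.
Qed.

(** * Holonomic probabilities and coboundaries *)

Section holonomic.
Local Open Scope ereal_scope.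
Context (R : realType) (d1 d2 : measure_display).
Context (Theta : measurableType d1) (Y : measurableType d2).
Variables (tau : Theta * Y -> Y) (pi : probability (Theta * Y)%type R).
Hypothesis mtau : measurable_fun setT tau.

(* Adding a constant to g changes both sides by the same amount. *)
Lemma ge0_holonomic :
    (forall g : Y -> R, measurable_fun setT g -> (forall y, (0 <= g y)%R) ->
       [bounded g y | y in setT] ->
     \int[pi]_x (g x.2)%:E = \int[pi]_x (g (tau x))%:E) ->
  holonomic tau pi.
Proof.
move=> hol g mg /bounded_fun_setTP[M gM].
have mgM : measurable_fun setT (fun y => g y + M)%R.
  exact: measurable_funD.
have gM_ge0 y : (0 <= g y + M)%R.
  by rewrite -lerBlDr sub0r; have := gM y; rewrite ler_norml => /andP[].
have gM_bounded : [bounded (g y + M)%R | y in setT].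
  apply/bounded_fun_setTP; exists (M + M)%R => y.
  by rewrite ger0_norm// lerD2r (le_trans _ (gM y))// ler_norm.
have shift (h : Theta * Y -> Y) : measurable_fun setT h ->
    \int[pi]_x (g (h x) + M)%:E = \int[pi]_x (g (h x))%:E + M%:E.
  move=> mh; under eq_integral do rewrite EFinD.
  rewrite integralD//; last 2 first.
  - by apply: (@bounded_integrable _ _ _ _ _ M) => //; exact: measurableT_comp.
  - exact: finite_measure_integrable_cst.
  by rewrite integral_cst//= probability_setT mule1.
have := hol _ mgM gM_ge0 gM_bounded.
rewrite (shift snd)// (shift tau)//.
by move=> /(congr1 (fun z => z - M%:E)); rewrite !addeK.
Qed.

Section coboundary.
Variables (J0 : Theta * Y -> R) (P : probability Theta R) (M : R).
Hypotheses (J0_jacobian : is_jacobian P J0) (J0_gt0 : forall x, (0 < J0 x)%R)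
  (J0_le : forall x, (J0 x <= M)%R).
Variables (b : Y -> R) (B : R).
Hypotheses (mb : measurable_fun setT b) (bB : forall y, (`|b y| <= B)%R).
Hypothesis pi_holonomic : holonomic tau pi.

Let ib2 : pi.-integrable setT (fun x => (b x.2)%:E).
Proof.
by apply: (@bounded_integrable _ _ _ _ _ B) => //; exact: measurableT_comp.
Qed.

Let ibtau : pi.-integrable setT (fun x => (b (tau x))%:E).
Proof.
by apply: (@bounded_integrable _ _ _ _ _ B) => //; exact: measurableT_comp.
Qed.

Let mlnJ0 : measurable_fun setT (fun x => ln (J0 x)).
Proof.
by case: J0_jacobian => mJ0 _ _; apply: measurableT_comp => //; exact: measurable_ln.
Qed.

(** With [b] equal to [ln psi], this is the integrand of the variational problem. *)
Let F x := (ln (J0 x) + b x.2 - b (tau x))%R.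

Let mF : measurable_fun setT F.
Proof.
by apply: measurable_funB; [apply: measurable_funD|];
  rewrite //; exact: measurableT_comp.
Qed.

Lemma integral_add_coboundary : pi.-integrable setT (fun x => (ln (J0 x))%:E) ->
  \int[pi]_x (F x)%:E = \int[pi]_x (ln (J0 x))%:E.
Proof.
move=> iJ0; rewrite /F.
under eq_integral do rewrite EFinB EFinD.
rewrite integralB//; last exact: integrableD.
rewrite integralD// pi_holonomic//; last by apply/bounded_fun_setTP; exists B.
by rewrite addeK// integrable_fin_num.
Qed.

Lemma integral_coboundary_entropy_le0 :
  \int[pi]_x (F x)%:E + entropy P pi <= 0.
Proof.
(* The integral of F may be -oo, in which case the entropy is irrelevant. *)
have [iF|niF] := pselect (pi.-integrable setT (EFin \o F)); last first.
  rewrite (@not_integrable_integral_Ny _ _ _ _ _ (ln M + B + B))//.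
    by rewrite addNye leNye.
  move=> x; rewrite /F -addrA -[leRHS]addrA lerD//.
    by rewrite ler_ln// posrE (lt_le_trans (J0_gt0 x)).
  apply: lerD; first exact: le_trans (ler_norm _) (bB _).
  by apply: le_trans (ler_norm _) _; rewrite normrN.
(* [ln J0] differs from [F] by a bounded function, so it inherits integrability. *)
have iJ0 : pi.-integrable setT (fun x => (ln (J0 x))%:E).
  rewrite (_ : (fun _ => _) =
      (fun x => (F x)%:E - ((b x.2)%:E - (b (tau x))%:E))); last first.
    by apply/funext => x; rewrite -!EFinB /F opprB addrA subrK addrK.
  by apply: integrableB => //; exact: integrableB.
rewrite integral_add_coboundary//.
rewrite -[leRHS](subee (integrable_fin_num measurableT iJ0)).
by rewrite leeD2l// entropy_le_integral_ln.
Qed.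

Lemma integral_coboundary_entropy_density (rho : probability Y R) :
  has_density (P \x rho) J0 pi -> \int[pi]_x (F x)%:E + entropy P pi = 0.
Proof.
move=> dpi.
have iJ0 := integrable_ln_density J0_jacobian J0_gt0 J0_le dpi.
rewrite integral_add_coboundary// (entropy_density J0_jacobian J0_gt0 J0_le dpi).
by rewrite subee// integrable_fin_num.
Qed.

End coboundary.

(** Both sides of holonomy equal the integral of [g] against [rho]: for [g x.2] because the density
    is a Jacobian, for [g (tau x)] by stationarity. Restricting to nonnegative [g] allows Tonelli's
    theorem. *)
Lemma stationary_holonomic (P nu : probability Theta R) (rho : probability Y R)
    (pia : Theta -> R) (lb : Theta * Y -> R) :
    measurable_fun setT pia -> (forall t, (0 <= pia t)%R) ->
    has_density P pia nu ->
    measurable_fun setT lb -> (forall x, (0 <= lb x)%R) ->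
    is_jacobian P (fun x => lb x * pia x.1)%R ->
    stationary lb nu tau rho ->
    has_density (P \x rho) (fun x => lb x * pia x.1)%R pi ->
  holonomic tau pi.
Proof.
move=> mpia pia0 dnu mlb lb0 [mJ J_ge0 J1] st dpi.
apply: ge0_holonomic => g mg g0 gb.
have mJE : measurable_fun setT (fun x => (lb x * pia x.1)%:E).
  exact/measurable_EFinP.
(* Serves for both [h = snd] and [h = tau]. *)
have change (h : Theta * Y -> Y) : measurable_fun setT h ->
    \int[pi]_x (g (h x))%:E =
    \int[rho]_y \int[P]_t ((g (h (t, y)))%:E * (lb (t, y) * pia t)%:E).
  move=> mh; have mgh : measurable_fun setT (fun x => (g (h x))%:E).
    by apply/measurable_EFinP/measurableT_comp.
  rewrite (ge0_integral_density mJ J_ge0 dpi)//; last first.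
    by move=> x; rewrite lee_fin.
  rewrite (fubini_tonelli2
    (fun x => (g (h x))%:E * (lb x * pia x.1)%:E))//; last first.
    by move=> x; rewrite -EFinM lee_fin mulr_ge0.
  exact: emeasurable_funM.
rewrite (change snd)// (change tau)//; transitivity (\int[rho]_y (g y)%:E).
  apply: eq_integral => y _ /=.
  rewrite ge0_integralZl ?lee_fin ?J1 ?mule1//.
  - exact: (measurable_fun_pair1 y mJE).
  - by move=> t _; rewrite lee_fin; exact: (J_ge0 (t, y)).
(* Stationarity integrates [lb] against [nu]; the density [pia] converts this to an integral against
   [P]. *)
rewrite -st//; apply: eq_integral => y _.
rewrite (ge0_integral_density mpia pia0 dnu)//.
- by apply: eq_integral => t _; rewrite -!EFinM mulrCA mulrA.
- apply/measurable_EFinP; apply: (measurable_fun_pair1 y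
    (f := fun x => lb x * g (tau x))%R).
  by apply: measurable_funM => //; exact: measurableT_comp.
- by move=> t; rewrite lee_fin mulr_ge0.
Qed.

End holonomic.

(** * The posterior density and the variational problem *)

Theorem theorem30 (R : realType) (d1 d2 : measure_display)
    (Theta : measurableType d1) (Y : measurableType d2)
    (P nu : probability Theta R) (pia : Theta -> R)
    (l : Theta * Y -> R) (tau : Theta * Y -> Y) (psi : Y -> R)
    (rho : probability Y R)
    (pia_meas : measurable_fun setT pia)
    (pia_gt0 : forall t, 0 < pia t)
    (pia_density : (\int[P]_t (pia t)%:E)%E = 1%E)
    (nu_density : has_density P pia nu)
    (l_meas : measurable_fun setT l)
    (l_bounded : [bounded l x | x in setT])
    (l_gt0 : forall x, 0 < l x)
    (tau_meas : measurable_fun setT tau)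
    (psi_meas : measurable_fun setT psi)
    (psi_bounded : [bounded psi y | y in setT])
    (psi_gt0 : forall y, 0 < psi y)
    (rho_stationary : stationary (lbar P pia l tau psi) nu tau rho)
    (pia_bounded : [bounded pia t | t in setT])
    (lower_bound : exists a : R,
       [/\ 0 < a, forall x, a < l x & forall y, a < psi y]) :
  ereal_sup [set objective P l pia (phi nu l tau psi) pi |
               pi in [set pi : probability (Theta * Y)%type R |
                        holonomic tau pi]] = 0%E
  /\ exists pi : probability (Theta * Y)%type R,
       [/\ has_density (P \x rho)%E
             (fun x => lbar P pia l tau psi x * pia x.1) pi,
           holonomic tau pi &
           objective P l pia (phi nu l tau psi) pi = 0%E].
Proof.
have [a [a0 al apsi]] := lower_bound.
have [L lL] := (bounded_fun_setTP l).1 l_bounded.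
have [S psiS] := (bounded_fun_setTP psi).1 psi_bounded.
have [K piaK] := (bounded_fun_setTP pia).1 pia_bounded.
have pia_ge0 t : 0 <= pia t by exact: ltW.
(* The unnormalized weight, which lies between [a * a] and [L * S]. *)
pose W x := l x * psi (tau x).
have W_gt0 x : 0 < W x by rewrite mulr_gt0.
have aW x : a * a <= W x by rewrite ler_pM// ltW.
have WLS x : W x <= L * S.
  apply: ler_pM; [exact: ltW|exact: ltW| |].
    exact: le_trans (ler_norm _) (lL x).
  exact: le_trans (ler_norm _) (psiS _).
have mpsitau : measurable_fun setT (psi \o tau) by exact: measurableT_comp.
have mW : measurable_fun setT W by exact: measurable_funM.
have mpia1 : measurable_fun setT (fun x : Theta * Y => pia x.1).
  exact: measurableT_comp.
pose Wpia x := W x * pia x.1.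
have mWpia : measurable_fun setT (EFin \o Wpia).
  exact/measurable_EFinP/measurable_funM.
have Wpia_ge0 x : (0 <= (Wpia x)%:E)%E by rewrite lee_fin mulr_ge0// ltW.
have mWpia1 y : measurable_fun setT (fun t => (Wpia (t, y))%:E).
  exact: (measurable_fun_pair1 y mWpia).
have mpiaE : measurable_fun setT (EFin \o pia) by exact/measurable_EFinP.
have int_cst_pia (c : R) : 0 <= c ->
    (\int[P]_t (c%:E * (pia t)%:E))%E = c%:E.
  move=> c0; rewrite ge0_integralZl// ?pia_density ?mule1//.
  by move=> t _; rewrite lee_fin.
have LS_ge0 : 0 <= L * S by apply: le_trans (WLS (point, point)); exact: ltW.
(* The denominator of [lbar]. Being an average of [W] for the density [pia], it inherits the bounds
   of [W]; finiteness lets the real-valued integral agree with the extended one. *)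
pose D y := \int[P]_t Wpia (t, y).
have DE y : (D y)%:E = (\int[P]_t (Wpia (t, y))%:E)%E.
  rewrite /D /Rintegral fineK// ge0_fin_numE ?integral_ge0//.
  apply: (@le_lt_trans _ _ (L * S)%:E); last exact: ltry.
  rewrite -(int_cst_pia (L * S))//; apply: ge0_le_integral => //.
  - exact: emeasurable_funM.
  - by move=> t _; rewrite -EFinM lee_fin ler_wpM2r.
have aD y : a * a <= D y.
  rewrite -lee_fin DE -(int_cst_pia (a * a)) ?mulr_ge0 ?(ltW a0)//.
  apply: ge0_le_integral => //.
  - by move=> t _; rewrite -EFinM lee_fin !mulr_ge0// ltW.
  - exact: emeasurable_funM.
  - by move=> t _; rewrite -EFinM lee_fin ler_wpM2r.
have D_gt0 y : 0 < D y by rewrite (lt_le_trans _ (aD y))// mulr_gt0.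
have mD : measurable_fun setT D.
  apply/measurable_EFinP; rewrite (_ : _ \o _ = fubini_G P (EFin \o Wpia)).
    exact: measurable_fun_fubini_tonelli_G.
  by apply/funext => y; exact: DE.
have lbarE x : lbar P pia l tau psi x = W x / D x.2 by [].
have mlbar : measurable_fun setT (lbar P pia l tau psi).
  apply: (@measurable_funM _ _ _ _ W (fun x => (D x.2)^-1)) => //.
  by apply: measurable_inv_gt0 => //; exact: measurableT_comp.
have lbar_gt0 x : 0 < lbar P pia l tau psi x by rewrite lbarE divr_gt0.
pose J0 x := lbar P pia l tau psi x * pia x.1.
have J0_gt0 x : 0 < J0 x by rewrite mulr_gt0.
have mJ0 : measurable_fun setT J0 by exact: measurable_funM.
have J0_jacobian : is_jacobian P J0.
  split=> // [x|y]; first exact: ltW.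
  transitivity (\int[P]_t ((D y)^-1%:E * (Wpia (t, y))%:E))%E.
    by apply: eq_integral => t _; rewrite /J0 lbarE -EFinM mulrAC mulrC.
  rewrite ge0_integralZl//; last by rewrite lee_fin invr_ge0 ltW.
  by rewrite -DE -EFinM mulVf// gt_eqF.
(* The factors bound [W], the inverse of [D] and [pia] respectively. *)
have J0_le x : J0 x <= L * S / (a * a) * K.
  apply: ler_pM; [exact: ltW|exact: ltW| |].
    rewrite lbarE; apply: ler_pM; [exact: ltW| |exact: WLS|].
      by rewrite invr_ge0 ltW.
    by rewrite lef_pV2 ?posrE ?mulr_gt0.
  exact: le_trans (ler_norm _) (piaK _).
(* [phi] integrates against [nu] and [D] against [P]; the density [pia] reconciles them. *)
have phiE y : phi nu l tau psi y = (psi y)^-1 * D y.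
  rewrite /phi; congr (_ * _); rewrite /D /Rintegral; congr fine.
  rewrite (ge0_integral_density pia_meas pia_ge0 nu_density).
  - by apply: eq_integral => t _; rewrite -EFinM.
  - by apply/measurable_EFinP; exact: (measurable_fun_pair1 y mW).
  - by move=> t; rewrite lee_fin ltW// W_gt0.
(* Both sides equal [ln l + ln pia + ln psi - ln D], with [psi] and [D] taken at [x.2]: the factor
   [psi (tau x)] in [J0] cancels the last term. *)
have integrandE x : ln (l x) + ln (pia x.1) - ln (phi nu l tau psi x.2) =
    ln (J0 x) + ln (psi x.2) - ln (psi (tau x)).
  rewrite phiE /J0 lbarE /W !lnM ?posrE ?divr_gt0 ?mulr_gt0 ?invr_gt0//.
  by rewrite !lnV ?posrE//; ring.
have mlnpsi : measurable_fun setT (fun y => ln (psi y)).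
  by apply: measurableT_comp => //; exact: measurable_ln.
(* Here [psi] takes values between [a > 0] and [S], so its logarithm is bounded on both sides. *)
have [B lnpsiB] : exists B, forall y, `|ln (psi y)| <= B.
  exists (`|ln a| + `|ln S|) => y.
  have ln_a : ln a <= ln (psi y) by rewrite ler_ln ?posrE// ltW.
  have ln_S : ln (psi y) <= ln S.
    have psi_le : psi y <= S by exact: le_trans (ler_norm _) (psiS y).
    by rewrite ler_ln ?posrE// (lt_le_trans (psi_gt0 y)).
  have := ler_norm (ln S); have := ler_norm (- ln a); rewrite normrN.
  have := normr_ge0 (ln S); have := normr_ge0 (ln a); rewrite ler_norml; lra.
have objectiveE pi : objective P l pia (phi nu l tau psi) pi =
    (\int[pi]_x (ln (J0 x) + ln (psi x.2) - ln (psi (tau x)))%:E +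
     entropy P pi)%E.
  by congr (_ + _)%E; apply: eq_integral => x _; rewrite integrandE.
have objective_le0 pi : holonomic tau pi ->
    (objective P l pia (phi nu l tau psi) pi <= 0)%E.
  move=> hol; rewrite objectiveE.
  exact: (integral_coboundary_entropy_le0 tau_meas J0_jacobian J0_gt0 J0_le
    mlnpsi lnpsiB hol).
have [pi dpi] : exists pi : probability (Theta * Y)%type R,
    has_density (P \x rho)%E J0 pi.
  apply: density_probability => //; first by move=> x; exact: ltW.
  exact: integral_jacobian.
have hol : holonomic tau pi.
  apply: (stationary_holonomic tau_meas pia_meas pia_ge0 nu_density mlbar
    _ J0_jacobian rho_stationary dpi).
  by move=> x; exact: ltW.
have obj0 : objective P l pia (phi nu l tau psi) pi = 0%E.
  rewrite objectiveE.
  exact: (integral_coboundary_entropy_density tau_meas J0_jacobian J0_gt0 J0_le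
    mlnpsi lnpsiB hol dpi).
split; last by exists pi.
apply/eqP; rewrite eq_le; apply/andP; split.
  by apply: ge_ereal_sup => _ [p holp <-]; exact: objective_le0.
by apply: ereal_sup_ubound; exists pi.
Qed.
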